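(* Let $f$ be a real-valued univariate function with domain $[0,U)$, where $U\in\{w\in\mathbb{R}: w>0\}\cup\{+\infty\}$. Assume that $f(0)=0$ and that $f$ is twice differentiable at every $\delta\in(0,U)$. Suppose further that $f$ is continuous on $[0,U)$ and thrice differentiable on $(0,U)$, and that $f'''$ is decreasing on $(0,U)$. Then the function $$\delta\mapsto g_1(\delta):=\frac{3f(\delta)}{\delta}-2f'(\delta)+\frac{\delta f''(\delta)}{2}$$ is decreasing on $(0,U)$.
   Context: Decreasing means strictly decreasing: $\phi(w_1)>\phi(w_2)$ for all $w_1<w_2$. The quantity $g_1(\delta)$ equals $g'(0)$, where $g$ is the $\delta$-smoothing of $f$, i.e. the function equal to $f$ on $(\delta,U)$ and on $[0,\delta]$ equal to the cubic polynomial $q$ with $q(0)=0$, $q(\delta)=f(\delta)$, $q'(\delta)=f'(\delta)$, $q''(\delta)=f''(\delta)$. *)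

(* Defs.v *)
From HB Require Import structures.
From mathcomp Require Import all_boot all_order all_algebra.
From mathcomp Require Import all_classical all_reals all_analysis.
Import Order.TTheory GRing.Theory Num.Theory.
Import numFieldNormedType.Exports.
Set Implicit Arguments.
Unset Strict Implicit.
Unset Printing Implicit Defensive.
Local Open Scope classical_set_scope.
Local Open Scope ring_scope.

(* A function with domain [0, U) is represented by a total
   function on R; nothing is assumed about its values outside [0, U). *)

Definition itv0co (R : realType) (U : \bar R) : set R :=
  [set x | 0 <= x /\ (x%:E < U)%E].

Definition itv0oo (R : realType) (U : \bar R) : set R :=
  [set x | 0 < x /\ (x%:E < U)%E].

(* [f^`(k)] is total (a default value where the derivative does not exist),
   so all the orders below [n] have to be required. On an open set [A] this
   depends on the values of [f] on [A] only. *)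
Definition times_differentiable_on (R : realType) (n : nat) (A : set R)
    (f : R -> R) : Prop :=
  forall k : nat, (k < n)%N -> forall x : R, A x -> derivable f^`(k)%classic x 1.

Definition decreasing_on (R : realType) (A : set R) (phi : R -> R) : Prop :=
  forall w1 w2 : R, A w1 -> A w2 -> w1 < w2 -> phi w1 > phi w2.

Definition g1 (R : realType) (f : R -> R) (delta : R) : R :=
  3 * f delta / delta - 2 * f^`()%classic delta + delta * f^`(2)%classic delta / 2.

(* Main.v *)
Require Import Defs.
From HB Require Import structures.
From mathcomp Require Import all_boot all_order all_algebra.
From mathcomp Require Import all_classical all_reals all_analysis.
From mathcomp Require Import ring.
Import Order.TTheory GRing.Theory Num.Theory.
Import numFieldNormedType.Exports.
Local Open Scope classical_set_scope.
Local Open Scope ring_scope.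

(** The derivative of [g1] at [x] is [3 / x ^+ 2] times
    [x f' x - f x - x^2 f'' x / 2 + x^3 f''' x / 6].
    That bracket is the opposite of the value at [0] of
    the cubic Taylor polynomial [T] of [f] at [x]. As [f 0 = 0], it is negative
    exactly when [f 0 < T 0], so it is enough to compare [f] with [T] at [0].

    The remainder [r = f - T] vanishes at [x] together with its first two
    derivatives, and [r''' t = f''' t - f''' x > 0] for [0 < t < x] because
    [f'''] decreases. Integrating this sign backwards from [x] gives [r'' < 0],
    then [r' > 0] on the open interval, and finally [r 0 < r x = 0]
    ([cubic_taylor_gt]). Only the last step reaches the end point [0], and there
    continuity of [f] suffices: the derivatives may blow up at [0]. *)

Lemma is_derive_gt0_lt (R : realType) (f df : R -> R) (a b : R) :
  a < b -> (forall x, x \in `]a, b[ -> is_derive x 1 f (df x)) ->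
  (forall x, x \in `]a, b[ -> 0 < df x) ->
  {within `[a, b], continuous f} -> f a < f b.
Proof.
move=> ab fdf df0 fc; have [c cab eq_c] := MVT ab fdf fc.
by rewrite -subr_gt0 eq_c mulr_gt0 ?df0// subr_gt0.
Qed.

Lemma is_derive_within_continuous {R : realType} {f df : R -> R} {a b : R} :
  (forall x, a <= x <= b -> is_derive x 1 f (df x)) ->
  {within `[a, b], continuous f}.
Proof.
move=> fdf; apply: derivable_within_continuous => x; rewrite in_itv/= => xab.
by have [] := fdf _ xab.
Qed.

(** A cubic has constant third derivative, and [(a - b) ^+ 3] is negative; so a
    third derivative larger than [f3 b] to the left of [b] pushes [f a] below the
    Taylor polynomial at [b]. Differentiability is asked at [b], where the
    expansion is made, but only continuity at [a]. *)
Lemma cubic_taylor_gt (R : realType) (f f1 f2 f3 : R -> R) (a b : R) :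
  a < b -> {within `[a, b], continuous f} ->
  (forall x, a < x <= b -> is_derive x 1 f (f1 x)) ->
  (forall x, a < x <= b -> is_derive x 1 f1 (f2 x)) ->
  (forall x, a < x <= b -> is_derive x 1 f2 (f3 x)) ->
  (forall x, a < x < b -> f3 b < f3 x) ->
  f a < f b + f1 b * (a - b) + f2 b / 2 * (a - b) ^+ 2
        + f3 b / 6 * (a - b) ^+ 3.
Proof.
move=> ab fc df df1 df2 f3b.
pose r2 x := f2 x - (f2 b + f3 b * (x - b)).
pose r1 x := f1 x - (f1 b + f2 b * (x - b) + f3 b / 2 * (x - b) ^+ 2).
pose T x := f b + f1 b * (x - b) + f2 b / 2 * (x - b) ^+ 2
            + f3 b / 6 * (x - b) ^+ 3.
have dr2 x : a < x <= b -> is_derive x 1 r2 (f3 x - f3 b).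
  move=> /df2 ?; rewrite /r2; apply: is_derive_eq.
  by rewrite /GRing.scale/=; ring.
have dr1 x : a < x <= b -> is_derive x 1 r1 (r2 x).
  move=> /df1 ?; rewrite /r1; apply: is_derive_eq.
  by rewrite /r2 /GRing.scale/=; field.
have dT (x : R) : is_derive x 1 T (f1 b + f2 b * (x - b) + f3 b / 2 * (x - b) ^+ 2).
  rewrite /T; apply: is_derive_eq.
  by rewrite /GRing.scale/=; field.
have r2_lt0 x : a < x < b -> r2 x < 0.
  move=> /andP[ax xb]; have -> : 0 = r2 b by rewrite /r2; ring.
  have dr2x y : x <= y <= b -> is_derive y 1 r2 (f3 y - f3 b).
    by move=> /andP[xy yb]; apply: dr2; rewrite (lt_le_trans ax).
  apply: (is_derive_gt0_lt _ _ _ _ _ xb _ _ (is_derive_within_continuous dr2x)) => y.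
    by rewrite in_itv/= => /andP[xy yb]; apply: dr2x; rewrite !ltW.
  rewrite in_itv/= => /andP[xy yb].
  by rewrite subr_gt0 f3b// (lt_trans ax).
(* Negating [r1] makes it increasing, so that the same criterion applies. *)
have r1_gt0 x : a < x < b -> 0 < r1 x.
  move=> /andP[ax xb]; rewrite -oppr_lt0.
  have -> : 0 = - r1 b by rewrite /r1; ring.
  have dr1x y : x <= y <= b -> is_derive y 1 (- r1) (- r2 y).
    move=> /andP[xy yb]; have ? : is_derive y 1 r1 (r2 y).
      by apply: dr1; rewrite (lt_le_trans ax).
    exact: is_deriveN.
  apply: (is_derive_gt0_lt _ _ _ _ _ xb _ _ (is_derive_within_continuous dr1x)) => y.
    by rewrite in_itv/= => /andP[xy yb]; apply: dr1x; rewrite !ltW.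
  rewrite in_itv/= => /andP[xy yb].
  by rewrite oppr_gt0 r2_lt0// (lt_trans ax).
(* The previous steps stay to the right of [a]; this one reaches it. *)
have : (f - T) a < (f - T) b.
  apply: (@is_derive_gt0_lt _ _ r1) => //.
  - move=> x; rewrite in_itv/= => /andP[ax xb].
    have ? : is_derive x 1 f (f1 x) by apply: df; rewrite ax ltW.
    exact: is_deriveB.
  - move=> x; apply: cvgB; first exact: fc.
    by apply: (is_derive_within_continuous (fun x _ => dT x)).
have -> : (f - T) b = 0 by rewrite !fctE /T; ring.
by rewrite !fctE subr_lt0.
Qed.

Lemma is_derive_derive1n (R : realType) (f : R -> R) (k : nat) (x : R) :
  derivable f^`(k)%classic x 1 ->
  is_derive x 1 f^`(k)%classic (f^`(k.+1)%classic x).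
Proof. by move=> df; rewrite (derive1nS f k) derive1E; apply/derivableP. Qed.

(** The factor [3 / x ^+ 2] is pulled out so that what remains is the opposite of
    a Taylor polynomial at [x] evaluated at [0]. *)
Lemma is_derive_g1 (R : realType) (f : R -> R) (x : R) : 0 < x ->
  (forall k, (k < 3)%N -> derivable f^`(k)%classic x 1) ->
  is_derive x 1 (g1 f)
    (3 / x ^+ 2 * (x * f^`()%classic x - f x - x ^+ 2 / 2 * f^`(2)%classic x
                   + x ^+ 3 / 6 * f^`(3)%classic x)).
Proof.
move=> x0 df; have xn0 : x != 0 by rewrite gt_eqF.
have df0 := is_derive_derive1n _ _ _ _ (df 0%N isT).
have df1 := is_derive_derive1n _ _ _ _ (df 1%N isT).
have df2 := is_derive_derive1n _ _ _ _ (df 2%N isT).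
rewrite derive1n0 derive1n1 in df0; rewrite derive1n1 in df1.
have dV := is_deriveV xn0 (is_derive_id x (1 : R)).
rewrite /g1; apply: is_derive_eq.
by rewrite /GRing.scale/=; field.
Qed.

Theorem theorem2p5 (R : realType) (U : \bar R) (f : R -> R)
    (U_gt0 : (0 < U)%E)
    (f0 : f 0 = 0)
    (f_diff2 : times_differentiable_on 2 (itv0oo U) f)
    (f_cont : {within itv0co U, continuous f})
    (f_diff3 : times_differentiable_on 3 (itv0oo U) f)
    (f3_decr : decreasing_on (itv0oo U) f^`(3)%classic) :
  decreasing_on (itv0oo U) (g1 f).
Proof.
move=> w1 w2 [w1_gt0 _] [_ w2U] w12.
have inU (x : R) : 0 < x <= w2 -> itv0oo U x.
  by move=> /andP[x0 xw2]; split=> //; apply: le_lt_trans w2U; rewrite lee_fin.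
pose dg x :=
  3 / x ^+ 2 * (x * f^`()%classic x - f x - x ^+ 2 / 2 * f^`(2)%classic x
                + x ^+ 3 / 6 * f^`(3)%classic x).
have dgE x : w1 <= x <= w2 -> is_derive x 1 (- g1 f) (- dg x).
  move=> /andP[w1x xw2]; have x0 := lt_le_trans w1_gt0 w1x.
  apply: is_deriveN; apply: is_derive_g1 => // k k3.
  by apply: f_diff3 => //; apply: inU; rewrite x0.
rewrite -ltrN2; apply: (@is_derive_gt0_lt _ (- g1 f) (fun x => - dg x)) => //.
- by move=> x; rewrite in_itv/= => /andP[w1x xw2]; apply: dgE; rewrite !ltW.
- move=> x; rewrite in_itv/= => /andP[w1x xw2].
  have x0 := lt_trans w1_gt0 w1x.
  have inx (y : R) : 0 < y <= x -> itv0oo U y.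
    by move=> /andP[y0 yx]; apply: inU; rewrite y0 (le_trans yx)// ltW.
  have df k : (k < 3)%N ->
      forall y : R, 0 < y <= x ->
        is_derive y 1 f^`(k)%classic (f^`(k.+1)%classic y).
    by move=> k3 y /inx yU; apply/is_derive_derive1n/f_diff3.
  have fc : {within `[0, x], continuous f}.
    apply: continuous_subspaceW f_cont => y /=; rewrite in_itv/= => /andP[y0 yx].
    split=> //; apply: le_lt_trans w2U.
    by rewrite lee_fin (le_trans yx)// ltW.
  have f3x (y : R) : 0 < y < x -> f^`(3)%classic x < f^`(3)%classic y.
    move=> /andP[y0 yx].
    by apply: f3_decr => //; apply: inx; rewrite ?x0 ?y0 ?lexx ?(ltW yx).
  have := cubic_taylor_gt _ _ _ _ _ _ _ x0 fc (df 0%N isT) (df 1%N isT) (df 2%N isT) f3x.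
  rewrite f0 derive1n1 => taylor0.
  rewrite oppr_gt0 pmulr_rlt0 ?divr_gt0 ?exprn_gt0//.
  rewrite -oppr_gt0; apply: lt_le_trans taylor0 _.
  by rewrite le_eqVlt; apply/orP; left; apply/eqP; field.
- exact: is_derive_within_continuous dgE.
Qed.
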